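(* Let $G$ be a finite simple graph without isolated vertices, with vertices $v_1,\ldots,v_n$, edge set $\mathcal{E}(G)$ and vertex degrees $d_1,\ldots,d_n$. Then $$s_Q(G)\ \ge\ 2\,\frac{\left(\sum_{i=1}^n d_i^2\,\sum_{i=1}^n\alpha_i^2-\left(\sum_{i=1}^n d_i\alpha_i\right)^2\right)^{1/2}}{\sum_{i=1}^n d_i^2},$$ where $\alpha_i=d_i^2+\sum_{j:\,v_iv_j\in\mathcal{E}(G)}d_j$ for $1\le i\le n$.
   Context: For a finite simple graph $G$ on $n$ vertices, let $A_G$ be its adjacency matrix and $D_G$ the diagonal matrix of vertex degrees. The signless Laplacian matrix is $Q_G=D_G+A_G$ with eigenvalues $q_1\ge q_2\ge\cdots\ge q_n$, and the signless Laplacian spread is $s_Q(G)=q_1-q_n$. *)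

(* Defs.v *)
From HB Require Import structures.
From mathcomp Require Import all_boot all_order all_algebra.
From mathcomp Require Import polyrcf.

Set Implicit Arguments.
Unset Strict Implicit.
Unset Printing Implicit Defensive.

Import Order.TTheory GRing.Theory Num.Theory.

Local Open Scope ring_scope.

Record sgraph (n : nat) := SGraph {
  adj : rel 'I_n;
  adj_sym : symmetric adj;
  adj_irrefl : irreflexive adj
}.

Definition deg n (G : sgraph n) (i : 'I_n) : nat := #|[set j | adj G i j]|.

Definition no_isolated n (G : sgraph n) : Prop :=
  forall i : 'I_n, deg G i <> 0%N.

Definition adjacency_mx (R : rcfType) n (G : sgraph n) : 'M[R]_n :=
  \matrix_(i, j) (adj G i j)%:R.

Definition degree_mx (R : rcfType) n (G : sgraph n) : 'M[R]_n :=
  diag_mx (\row_i (deg G i)%:R).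

Definition signless_laplacian (R : rcfType) n (G : sgraph n) : 'M[R]_n :=
  degree_mx R G + adjacency_mx R G.

(* The eigenvalues of A lying in R, in nonincreasing order, each repeated
   according to its multiplicity in the characteristic polynomial. The list
   has exactly n entries when A is symmetric. *)
Definition eigenvalues (R : rcfType) n (A : 'M[R]_n) : seq R :=
  sort >=%R
    (flatten [seq nseq (mup x (char_poly A)) x | x <- rootsR (char_poly A)]).

(* Positions are counted from 0: q_1 is entry 0 and q_n is entry n.-1. *)
Definition signless_spread (R : rcfType) n (G : sgraph n) : R :=
  let q := eigenvalues (signless_laplacian R G) in q`_0 - q`_n.-1.

Definition alpha n (G : sgraph n) (i : 'I_n) : nat :=
  (deg G i ^ 2 + \sum_(j | adj G i j) deg G j)%N.

(* Main.v *)
(* With d the vector of degrees, Q d is the vector alpha, so the radicand is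
   |d|^2 |Qd|^2 - <d, Qd>^2. If q_n <= e_i <= q_1 are the eigenvalues of Q and
   w_i >= 0 the squared coordinates of d in an orthonormal eigenbasis, then
   sum_i w_i (q_1 - e_i) (e_i - q_n) >= 0 reads
   |Qd|^2 <= (q_1 + q_n) <d, Qd> - q_1 q_n |d|^2; multiplying by |d|^2 and
   completing the square bounds the radicand by ((q_1 - q_n) |d|^2 / 2)^2. *)

Require Import Defs.
From mathcomp Require Import all_boot all_order all_algebra.
From mathcomp Require Import sesquilinear spectral polyrcf complex ring lra.

Import Order.TTheory GRing.Theory Num.Theory.

Local Open Scope ring_scope.

(** The scalar matrix of ['X] is fixed by conjugation, so the whole characteristic matrix is
    conjugated and the determinants of [iP] and [P'] cancel. *)
Lemma char_poly_conj (F : fieldType) (n : nat) (P D : 'M[F]_n) :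
  P \in unitmx -> char_poly (invmx P *m D *m P) = char_poly D.
Proof.
move=> Pu; set iP := map_mx polyC (invmx P); set P' := map_mx polyC P.
have PK : iP *m P' = 1%:M by rewrite -map_mxM mulVmx // map_mx1.
have -> : char_poly (invmx P *m D *m P) = \det (iP *m char_poly_mx D *m P').
  congr (\det _); rewrite /char_poly_mx !map_mxM mulmxBr mulmxBl.
  by rewrite mul_mx_scalar -scalemxAl PK scalemx1.
by rewrite !det_mulmx mulrAC -det_mulmx PK det1 mul1r.
Qed.

Lemma expmx_conj (F : fieldType) (n : nat) (P : 'M[F]_n) (s : 'rV[F]_n) k :
  P \in unitmx ->
  (invmx P *m diag_mx s *m P) ^+ k
    = invmx P *m diag_mx (\row_i (s 0 i ^+ k)) *m P.
Proof.
move=> Pu; elim: k => [|k IH].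
  have -> : \row_i s 0 i ^+ 0 = const_mx 1.
    by apply/rowP => i; rewrite !mxE expr0.
  by rewrite expr0 diag_const_mx mulmx1 mulVmx.
rewrite exprS IH -[_ * _]/(_ *m _) !mulmxA mulmxK // -(mulmxA (invmx P)).
rewrite mulmx_diag; do 2 congr (_ *m _); congr diag_mx.
by apply/rowP => i; rewrite !mxE exprS.
Qed.

Section Eigenvalues.
Variable R : rcfType.

(** Both lists contain each [x] as often as its multiplicity in [char_poly A]: [rootsR] is
    duplicate-free, so only the block of [x] counts, and a non-root has multiplicity zero. *)
Lemma eigenvalues_perm (n : nat) (A : 'M[R]_n) (s : seq R) :
  char_poly A = \prod_(x <- s) ('X - x%:P) -> perm_eq (eigenvalues A) s.
Proof.
move=> pA; have p0 : char_poly A != 0 by rewrite monic_neq0 ?char_poly_monic.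
rewrite /eigenvalues perm_sort; apply/allP => x _ /=; apply/eqP.
rewrite -[RHS]mu_prod_XsubC -pA count_flatten -map_comp sumnE big_map.
rewrite (eq_bigr (fun y => (y == x) * mup y (char_poly A))%N); last first.
  by move=> y _ /=; rewrite count_nseq.
have [xr|xr] := boolP (x \in rootsR (char_poly A)).
  rewrite (bigD1_seq x) ?uniq_roots //= eqxx mul1n big1 ?addn0 // => y yx.
  by rewrite (negPf yx).
rewrite big_seq big1 => [|y yr].
  rewrite mupNroot //; apply: contra xr => rx.
  by rewrite -(roots_on_rootsR p0) rx andbT in_itv.
by case: eqP => // yx; rewrite -yx yr in xr.
Qed.

Local Notation toC := (real_complex R).

(* w is the vector of squared moduli of the coordinates of v in a unitary
   eigenbasis of A over R[i]. *)
Lemma symmetric_spectral (n : nat) (A : 'M[R]_n) : A^T = A ->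
  exists e : 'I_n -> R,
    char_poly A = \prod_(i < n) ('X - (e i)%:P) /\
    forall v : 'rV[R]_n, exists2 w : 'I_n -> R, (forall i, 0 <= w i) &
      forall k, (v *m A ^+ k *m v^T) 0 0 = \sum_i w i * e i ^+ k.
Proof.
move=> symA; set B := map_mx toC A.
have Breal : B \is a mxOver Num.real.
  by apply/mxOverP => i j; rewrite mxE; apply/complex_realP; exists (A i j).
have Bsym : B \is symmetricmx.
  by apply/is_hermitianmxP; rewrite expr0 scale1r map_mx_id // map_trmx symA.
have Bherm := realsym_hermsym Bsym Breal.
have /orthomx_spectralP := hermitian_normalmx Bherm.
have /mxOverP sreal := hermitian_spectral_diag_real Bherm.
move: sreal (spectral_unitarymx B) (spectral_unit B).
set P := spectralmx B; set s := spectral_diag B => sreal Puni Punit BE.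
(* [B] is Hermitian, so its spectrum is real and taking real parts loses nothing. *)
pose e i := complex.Re (s 0 i).
have sE i : s 0 i = toC (e i) by rewrite /e RRe_real.
exists e; split.
  apply: (map_poly_inj toC); rewrite map_char_poly -/B BE char_poly_conj //.
  rewrite char_poly_trig ?diag_mx_is_trig // rmorph_prod /=.
  apply: eq_bigr => i _; rewrite mxE eqxx mulr1n sE.
  by rewrite rmorphB /= map_polyX map_polyC.
move=> v; pose u := P *m (map_mx toC v)^T.
pose w i := complex.Re (u i 0) ^+ 2 + complex.Im (u i 0) ^+ 2.
exists w => [i|k]; first by rewrite addr_ge0 ?sqr_ge0.
apply: (@complexI R).
have -> : toC ((v *m A ^+ k *m v^T) 0 0)
    = (map_mx toC v *m B ^+ k *m (map_mx toC v)^T) 0 0.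
  have -> : B ^+ k = map_mx toC (A ^+ k).
    elim: k => [|k IH]; first by rewrite !expr0 map_mx1.
    by rewrite !exprS IH -[_ * _]/(_ *m _) -map_mxM.
  by rewrite map_trmx -!map_mxM [RHS]mxE.
rewrite BE expmx_conj // !mulmxA -mulmxA -/u.
(* The inverse of the unitary [P] is its conjugate transpose and [v] is real. Hence the form becomes
   a sum of [s 0 i ^+ k] weighted by [u i 0] times its conjugate. *)
have -> : map_mx toC v *m invmx P = (map_mx Num.conj u)^T.
  rewrite invmx_unitary // /u map_mxM trmx_mul !map_trmx trmxK.
  congr (_ *m _); apply/rowP => i; rewrite !mxE.
  by apply/esym/CrealP/complex_realP; exists (v 0 i).
rewrite mul_mx_diag mxE rmorph_sum; apply: eq_bigr => i _.
rewrite !mxE rmorphM rmorphXn /= -sE /w add_Re2_Im2 normCK [u i 0]mxE; ring.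
Qed.

(** The sorted list is a permutation of the values of [e], so it has exactly [n] entries and [n.-1]
    is its last position rather than a default. *)
Lemma eigenvalues_bounds (n : nat) (A : 'M[R]_n) (e : 'I_n -> R) :
  char_poly A = \prod_(i < n) ('X - (e i)%:P) ->
  forall i, (eigenvalues A)`_n.-1 <= e i <= (eigenvalues A)`_0.
Proof.
move=> pA i; set q := eigenvalues A.
have pq : perm_eq q (codom e).
  by apply: eigenvalues_perm; rewrite pA codomE big_map big_enum.
have sq : size q = n by rewrite (perm_size pq) size_codom card_ord.
have eiq : e i \in q by rewrite (perm_mem pq) codom_f.
have srt : sorted >=%R q by apply: sort_sorted; exact: ge_total.
have idx : (index (e i) q < n)%N by rewrite -[X in (_ < X)%N]sq index_mem.
have le j k : (j <= k < n)%N -> q`_k <= q`_j.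
  move=> /andP[jk kn].
  have := sorted_leq_nth (@ge_trans _ R) (@ge_refl _ R) 0 srt; apply=> //.
    by rewrite inE sq (leq_ltn_trans jk).
  by rewrite inE sq.
have n0 : (0 < n)%N by exact: leq_ltn_trans idx.
by rewrite -(nth_index 0 eiq) !le //= prednK ?leqnn ?andbT // -ltnS prednK.
Qed.

(** The [m k] are moments of the weights [w] on the spectrum, and the radicand is their unnormalised
    variance. Leaving [m 0] undivided covers [v = 0] too. *)
Lemma symmetric_spread (n : nat) (A : 'M[R]_n) (v : 'rV[R]_n) :
  let q := eigenvalues A in let m k := (v *m A ^+ k *m v^T) 0 0 in
  A^T = A ->
  2 * Num.sqrt (m 0%N * m 2%N - m 1%N ^+ 2) <= (q`_0 - q`_n.-1) * m 0%N.
Proof.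
move=> q m symA.
have [e [pA /(_ v)[w w0 mE]]] := symmetric_spectral n A symA.
have qe := eigenvalues_bounds n A e pA.
have : 0 <= \sum_i w i * ((q`_0 - e i) * (e i - q`_n.-1)).
  apply: sumr_ge0 => i _; have /andP[le1 le2] := qe i.
  by rewrite mulr_ge0 // mulr_ge0 ?subr_ge0.
have -> : \sum_i w i * ((q`_0 - e i) * (e i - q`_n.-1))
    = (q`_0 + q`_n.-1) * m 1%N - m 2%N - q`_0 * q`_n.-1 * m 0%N.
  rewrite /m !mE !mulr_sumr -!sumrB; apply: eq_bigr => i _.
  by rewrite expr0 expr1; ring.
have m0 : 0 <= m 0%N.
  by rewrite /m mE sumr_ge0 // => i _; rewrite expr0 mulr1.
(* Each summand supplies an index [i] to compare through, so [n = 0] needs no separate case. *)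
have spread0 : 0 <= (q`_0 - q`_n.-1) * m 0%N.
  rewrite /m mE mulr_sumr; apply: sumr_ge0 => i _.
  have /andP[le1 le2] := qe i.
  by rewrite expr0 mulr1 mulr_ge0 // subr_ge0 (le_trans le1).
move: (q`_0) (q`_n.-1) (m 0%N) (m 1%N) (m 2%N) m0 spread0.
move=> M l z y x z0 spread0 key.
rewrite mulrC -ler_pdivlMr ?ltr0n // -[leRHS]ger0_norm ?divr_ge0 ?ler0n //.
rewrite -sqrtr_sqr ler_wsqrtr //.
(* These two nonnegative terms sum to exactly [((M - l) * z / 2) ^+ 2 - (z * x - y ^+ 2)]. *)
have := mulr_ge0 z0 key; have := sqr_ge0 (y - (M + l) * z / 2).
by rewrite !expr2; lra.
Qed.

End Eigenvalues.

Lemma signless_laplacian_sym (R : rcfType) (n : nat) (G : sgraph n) :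
  (signless_laplacian R G)^T = signless_laplacian R G.
Proof.
rewrite /signless_laplacian linearD /= tr_diag_mx; congr (_ + _).
by apply/matrixP => i j; rewrite !mxE adj_sym.
Qed.

Lemma deg_mul_signless_laplacian (R : rcfType) (n : nat) (G : sgraph n) :
  (\row_i (deg G i)%:R) *m signless_laplacian R G = \row_i (alpha G i)%:R.
Proof.
apply/rowP => i; rewrite mulmxDr mul_mx_diag !mxE /alpha natrD natrX expr2.
congr (_ + _); rewrite natr_sum [RHS]big_mkcond; apply: eq_bigr => j _.
by rewrite !mxE adj_sym; case: adj; rewrite (mulr1, mulr0).
Qed.

Theorem corollary25 (R : rcfType) (n : nat) (G : sgraph n)
    (hG : no_isolated G) :
  signless_spread R G >=
    2 * (Num.sqrt ((\sum_(i < n) (deg G i)%:R ^+ 2)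
                     * (\sum_(i < n) (alpha G i)%:R ^+ 2)
                   - (\sum_(i < n) (deg G i)%:R * (alpha G i)%:R) ^+ 2)
         / (\sum_(i < n) (deg G i)%:R ^+ 2)).
Proof.
set d := \row_i (deg G i)%:R : 'rV[R]_n; set Q := signless_laplacian R G.
have := symmetric_spread R n Q d (signless_laplacian_sym R n G).
have -> : (d *m Q ^+ 0 *m d^T) 0 0 = \sum_(i < n) (deg G i)%:R ^+ 2.
  by rewrite expr0 mulmx1 mxE; apply: eq_bigr => i _; rewrite !mxE.
have -> : (d *m Q ^+ 1 *m d^T) 0 0
    = \sum_(i < n) (deg G i)%:R * (alpha G i)%:R.
  rewrite expr1 deg_mul_signless_laplacian mxE.
  by apply: eq_bigr => i _; rewrite !mxE mulrC.
have -> : (d *m Q ^+ 2 *m d^T) 0 0 = \sum_(i < n) (alpha G i)%:R ^+ 2.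
  (* By symmetry one factor [Q] goes to each copy of [d], leaving the squared norm of the vector
     [alpha]. *)
  rewrite expr2 -[Q * Q]/(Q *m Q) mulmxA deg_mul_signless_laplacian -mulmxA.
  have -> : Q *m d^T = (d *m Q)^T by rewrite trmx_mul signless_laplacian_sym.
  rewrite deg_mul_signless_laplacian mxE.
  by apply: eq_bigr => i _; rewrite !mxE.
rewrite -/(signless_spread R G).
set z := \sum_i _ ^+ 2 => le.
have : 0 <= z by rewrite sumr_ge0 // => i _; rewrite sqr_ge0.
rewrite le0r => /predU1P[z0|z0]; last by rewrite mulrA ler_pdivrMr.
(* Division by zero yields 0 here. With no isolated vertex, [z = 0] forces [n = 0]; then both
   positions [0] and [n.-1] coincide and the spread is 0. *)
rewrite z0 invr0 !mulr0.
case: n G hG @d @Q @z le z0 => [|n] G hG d Q z _ z0.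
  by rewrite /signless_spread subrr.
have /eqP : (deg G ord0)%:R ^+ 2 = 0 :> R.
  by apply: (psumr_eq0P _ z0) => // i _; exact: sqr_ge0.
by rewrite sqrf_eq0 pnatr_eq0 => /eqP /hG.
Qed.
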